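(* Let $d_{i,j}\in[0,1]$, $(i,j)\in\{-1,0,1\}^2$, be weights with $\sum_{(i,j)}d_{i,j}=1$, and let $t\in\,]0,1[$ be transcendental over the field $\mathbb{Q}(d_{i,j})$ generated by all the weights. The corresponding model of walk is degenerate if and only if at least one of the following holds: (1) there exists $i\in\{-1,1\}$ such that $d_{i,-1}=d_{i,0}=d_{i,1}=0$; (2) there exists $j\in\{-1,1\}$ such that $d_{-1,j}=d_{0,j}=d_{1,j}=0$; (3) all the weights are $0$ except maybe $d_{1,1},d_{0,0},d_{-1,-1}$, or all the weights are $0$ except maybe $d_{-1,1},d_{0,0},d_{1,-1}$.
   Context: The kernel polynomial is $$K(x,y,t)=xy\Big(1-t\sum_{(i,j)\in\{-1,0,1\}^2}d_{i,j}x^iy^j\Big).$$ For the fixed number $t$ it is regarded as an element of $\mathbb{C}[x,y]$. The model of walk is called degenerate if one of the following holds: $K(x,y,t)$ is reducible as an element of the polynomial ring $\mathbb{C}[x,y]$; or $K(x,y,t)$ has $x$-degree less than or equal to $1$; or $K(x,y,t)$ has $y$-degree less than or equal to $1$. *)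

(* Defs.v *)
From mathcomp Require Import all_boot all_order all_algebra.
From mathcomp Require Import complex.
From mathcomp Require Import reals.

Set Implicit Arguments.
Unset Strict Implicit.
Unset Printing Implicit Defensive.

Import Order.TTheory GRing.Theory Num.Theory.
Local Open Scope ring_scope.
Local Open Scope complex_scope.

(* A family of weights is a function [d : int -> int -> R] of which only the
   values at indices in [steps] are ever used. *)
Definition steps : seq int := [:: -1; 0; 1].

(* C[x,y] is {poly {poly R[i]}} with x = 'X (outer variable) and y = 'Y.
   The factor xy is distributed over the sum, so that
   xy * x^i y^j = x^(i+1) y^(j+1) has natural-number exponents. *)
Definition kernel (R : realType) (d : int -> int -> R) (t : R) :
    {poly {poly R[i]}} :=
  'X * 'Y
  - \sum_(i <- steps) \sum_(j <- steps)
      (t * d i j)%:C%:P%:P * ('X ^+ absz (i + 1) * 'Y ^+ absz (j + 1)).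

(* Only meaningful for nonzero elements; a kernel with weights in [0,1] and
   0 < t < 1 is nonzero, the coefficient of xy being 1 - t * d 0 0. *)
Definition reducible (A : idomainType) (p : A) : Prop :=
  exists f g : A,
    [/\ p = f * g, f \isn't a GRing.unit & g \isn't a GRing.unit].

(* [size] and [sizeY] are one more than the x-degree and the y-degree. *)
Definition degenerate (R : realType) (d : int -> int -> R) (t : R) : Prop :=
  [\/ reducible (kernel d t),
      ((size (kernel d t)).-1 <= 1)%N
    | ((sizeY (kernel d t)).-1 <= 1)%N].

(* Membership in the field Q(d i j), the smallest subfield of R containing all
   the weights; in characteristic 0 every subfield contains Q. *)
Definition in_weight_field (R : realType) (d : int -> int -> R) (z : R) : Prop :=
  forall S : {pred R}, divring_closed S ->
    {in steps &, forall i j : int, d i j \in S} -> z \in S.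

Definition transcendental_over (R : realType) (F : R -> Prop) (t : R) : Prop :=
  forall p : {poly R}, (forall k, F p`_k) -> root p t -> p = 0.

(* Main.v *)
From HB Require Import structures.
Require Import Defs.
From mathcomp Require Import all_boot all_order all_algebra.
From mathcomp Require Import complex.
From mathcomp Require Import ring.
From mathcomp Require Import boolp reals.

Set Implicit Arguments.
Unset Strict Implicit.
Unset Printing Implicit Defensive.

Import Order.TTheory GRing.Theory Num.Theory.
Local Open Scope ring_scope.

(** Write [w m n] for the weight [d (m - 1) (n - 1)], so that the kernel is the
    polynomial of bidegree at most (2, 2) whose coefficient at [x^m y^n] is
    [- t w m n], plus the extra term [xy].  If row 2 or column 2 of [w] is zero,
    the degree in [x] or [y] is at most 1; if row 0 or column 0 is zero, [x] or
    [y] divides the kernel.  A kernel supported on a diagonal is a quadratic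
    expression in [xy], or a quadratic form in [x] and [y]: it splits over the
    complex numbers if its leading coefficient is nonzero, and otherwise its
    degree in [x] is at most 1.  These are the easy implications
    ([size_kernel_row], [reducible_row0], [reducible_diagonal],
    [reducible_antidiagonal]).

    Conversely, let [K = f g] with nonconstant factors and no extreme row or
    column of [w] equal to zero.  Call a number algebraic when it is algebraic
    over the field of weights.

    If a factor involves only [y], it has a root [y0], at which every
    coefficient of [K] in [x] vanishes.  The constant coefficient in [x] shows
    that [y0] is algebraic, and the coefficient of [x] reads
    [y0 = t W(y0)] with [W(y0)] algebraic.  As the column [w _ 0] is nonzero,
    [y0] is nonzero, so [t] would be algebraic ([no_univariate_factor]).
    Exchanging [x] and [y] excludes factors in [x] alone.

    Hence both factors have bidegree (1, 1): [f = f0 + f1 x], [g = g0 + g1 x]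
    with [fi], [gi] of degree at most 1 in [y].  Put [P = f0 g1 / t] and
    [Q = f1 g0 / t], and let [Wi] be the polynomial with coefficients [w i _].
    Comparing coefficients of powers of [x] gives
      [P + Q = y / t - W1]  and  [P Q = W0 W2 <> 0].
    The outer coefficients of [P] and [Q] have algebraic sums and products, so
    they are algebraic, whereas the middle ones [p1], [q1] have a transcendental
    sum and an algebraic product, so both are transcendental.  Every linear
    relation with algebraic coefficients between [1], [p1] and [q1 = c / p1] is
    then trivial; those given by the coefficients of degree 1 and 3 of [P Q] force the outer coefficients
    to vanish ([end_coefs_eq0]).  Therefore [W1] is a multiple of [y] and
    [W0 W2] one of [y^2], so [W0] and [W2] are multiples of monomials whose
    degrees add up to 2.  They are not both multiples of [y], since column 0 is
    nonzero; what is left is the two diagonals ([support_dichotomy]). *)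

(** * Algebraic and transcendental numbers *)

Section Algebraic.

Variables (F E : fieldType) (phi : {rmorphism F -> E}).
Local Notation alg := (algebraicOver phi).

Lemma algebraic_root_quadratic (c0 c1 c2 z : E) :
    alg c0 -> alg c1 -> alg c2 -> ~ [/\ c0 = 0, c1 = 0 & c2 = 0] ->
  c0 + c1 * z + c2 * z ^+ 2 = 0 -> alg z.
Proof.
move=> a0 a1 a2 c_neq0 cz0; apply/integral_algebraic.
pose p := Poly [:: c0; c1; c2].
apply: (@integral_root _ _ _ p).
- apply/eqP => p0; apply: c_neq0.
  have cE k : [:: c0; c1; c2]`_k = 0 by rewrite -coef_Poly -/p p0 coef0.
  by split; [exact: (cE 0%N) | exact: (cE 1%N) | exact: (cE 2%N)].
- by apply/rootP; rewrite horner_Poly /= -[RHS]cz0; ring.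
apply/integral_poly => i; rewrite coef_Poly; apply/integral_algebraic.
by case: i => [|[|[|i]]] //=; rewrite nth_nil; apply: algebraic0.
Qed.

Lemma transcendental_neq0 (x : E) : ~ alg x -> x != 0.
Proof.
by move=> tx; apply/eqP => x0; apply: tx; rewrite x0; apply: algebraic0.
Qed.

Lemma algebraic_divr (x y z : E) :
  x * y = z -> alg x -> alg z -> x != 0 -> alg y.
Proof.
by move=> <- ax az x0; rewrite -[y](mulKf x0) mulrC; apply: algebraic_div.
Qed.

(** The setting is a factorization [P Q = M] with [P = p0 + p1 X + p2 X^2],
    [Q = q0 + q1 X + q2 X^2], [M = m0 + ... + m4 X^4] nonzero and
    [P + Q = s X - (b0 + b1 X + b2 X^2)].  Everything is stated on coefficients,
    because only field operations on them are used. *)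
Section MovingFactorization.

Variables b0 b1 b2 m0 m1 m2 m3 m4 s : E.
Hypotheses (alg_b0 : alg b0) (alg_b1 : alg b1) (alg_b2 : alg b2).
Hypotheses (alg_m0 : alg m0) (alg_m1 : alg m1) (alg_m2 : alg m2).
Hypotheses (alg_m3 : alg m3) (alg_m4 : alg m4) (trans_s : ~ alg s).
Hypothesis m_neq0 : ~ [/\ m0 = 0, m1 = 0, m2 = 0, m3 = 0 & m4 = 0].

(** Numbers with algebraic sum and product are the roots of a quadratic
    polynomial with algebraic coefficients. *)
Lemma end_coef_algebraic (b m p q : E) : alg b -> alg m ->
  p + q = - b -> p * q = m -> alg p.
Proof.
move=> ab am pq_b pq_m; apply: (@algebraic_root_quadratic m b 1) => //.
- exact: algebraic1.
- by case=> _ _ /eqP; rewrite oner_eq0.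
have -> : b = - (p + q) by rewrite pq_b opprK.
by rewrite -pq_m; ring.
Qed.

(** If [p1] were algebraic, [q1 = s - b1 - p1] would be transcendental, and the
    coefficients of degrees 1, 2 and 3 of [P Q] would give [p0], [p1] and [p2]
    algebraic products with [q1], hence [P = 0] and [M = 0]. *)
Lemma middle_coef_transcendental (p0 p1 p2 q0 q1 q2 : E) :
    p0 + q0 = - b0 -> p1 + q1 = s - b1 -> p2 + q2 = - b2 ->
    p0 * q0 = m0 -> p0 * q1 + p1 * q0 = m1 ->
    p0 * q2 + p1 * q1 + p2 * q0 = m2 ->
    p1 * q2 + p2 * q1 = m3 -> p2 * q2 = m4 ->
  ~ alg p1.
Proof.
move=> S0 S1 S2 M0 M1 M2 M3 M4 ap1.
have ap0 : alg p0 by apply: end_coef_algebraic S0 M0.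
have ap2 : alg p2 by apply: end_coef_algebraic S2 M4.
have aq0 : alg q0.
  by apply: (@end_coef_algebraic b0 m0 q0 p0); rewrite 1?addrC 1?mulrC.
have aq2 : alg q2.
  by apply: (@end_coef_algebraic b2 m4 q2 p2); rewrite 1?addrC 1?mulrC.
have nq1 : ~ alg q1.
  move=> aq1; apply: trans_s; have -> : s = p1 + q1 + b1 by rewrite S1 subrK.
  by do 2?[apply: algebraic_add].
have vanish x y : alg x -> alg y -> x * q1 = y -> x = 0.
  by move=> ax ay xy; apply/eqP/negP => /negP x0; apply/nq1/(algebraic_divr xy).
have p10 : p1 = 0.
  apply: (@vanish _ (m2 - p0 * q2 - p2 * q0)) => //; last by rewrite -M2; ring.
  by do !apply: algebraic_sub => //; apply: algebraic_mul.
rewrite p10 !(mul0r, addr0, add0r) in M1 M2 M3.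
have p00 := vanish _ _ ap0 alg_m1 M1; have p20 := vanish _ _ ap2 alg_m3 M3.
by apply: m_neq0; rewrite -M0 -M1 -M2 -M3 -M4 p00 p20 !mul0r addr0.
Qed.

(** Since [p1] and [q1] are transcendental with algebraic product, no
    nontrivial algebraic combination of them is algebraic, so the outer
    coefficients of [P] and [Q] vanish; this kills all coefficients of [M] and
    of [P + Q] except the middle ones. *)
Lemma end_coefs_eq0 (p0 p1 p2 q0 q1 q2 : E) :
    p0 + q0 = - b0 -> p1 + q1 = s - b1 -> p2 + q2 = - b2 ->
    p0 * q0 = m0 -> p0 * q1 + p1 * q0 = m1 ->
    p0 * q2 + p1 * q1 + p2 * q0 = m2 ->
    p1 * q2 + p2 * q1 = m3 -> p2 * q2 = m4 ->
  [/\ b0 = 0 & b2 = 0] /\ [/\ m0 = 0, m1 = 0, m3 = 0 & m4 = 0].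
Proof.
move=> S0 S1 S2 M0 M1 M2 M3 M4.
have np1 : ~ alg p1 by apply: middle_coef_transcendental S0 S1 S2 M0 M1 M2 M3 M4.
have nq1 : ~ alg q1.
  by apply: (@middle_coef_transcendental q0 q1 q2 p0 p1 p2);
     rewrite // -?S0 -?S1 -?S2 -?M0 -?M1 -?M2 -?M3 -?M4; ring.
have ap0 : alg p0 by apply: end_coef_algebraic S0 M0.
have ap2 : alg p2 by apply: end_coef_algebraic S2 M4.
have aq0 : alg q0.
  by apply: (@end_coef_algebraic b0 m0 q0 p0); rewrite 1?addrC 1?mulrC.
have aq2 : alg q2.
  by apply: (@end_coef_algebraic b2 m4 q2 p2); rewrite 1?addrC 1?mulrC.
have ac : alg (p1 * q1).
  have -> : p1 * q1 = m2 - p0 * q2 - p2 * q0 by rewrite -M2; ring.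
  by do !apply: algebraic_sub => //; apply: algebraic_mul.
have c0 : p1 * q1 != 0 by rewrite mulf_neq0 ?transcendental_neq0.
(* As [q1 = c / p1] with [c = p1 q1] algebraic, multiplying a relation
   [x q1 + p1 y = m] by [p1] gives a quadratic equation for [p1]. *)
have vanish x y m : alg x -> alg y -> alg m ->
  x * q1 + p1 * y = m -> x = 0 /\ y = 0.
  move=> ax ay am xy; apply: contrapT => xy0; apply: np1.
  apply: (@algebraic_root_quadratic (x * (p1 * q1)) (- m) y) => //.
  - exact: algebraic_mul.
  - exact: algebraic_opp.
  - by case=> /eqP; rewrite mulf_eq0 (negPf c0) orbF => /eqP x0 _ y0; apply: xy0.
  by rewrite -xy; ring.
have [p00 q00] := vanish _ _ _ ap0 aq0 alg_m1 M1.
have [p20 q20] := vanish _ _ _ ap2 aq2 alg_m3 (etrans (addrC _ _) M3).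
rewrite -M0 -M1 -M3 -M4 p00 q00 p20 q20 !(mulr0, mul0r, addr0).
by rewrite -[b0]opprK -[b2]opprK -S0 -S2 p00 q00 p20 q20 addr0 oppr0.
Qed.

End MovingFactorization.
End Algebraic.

(** * Arrays of weights and exchange of the variables *)

(** [K] has the coefficients of a kernel; this form, unlike the closed formula,
    is visibly invariant under exchanging the variables. *)
Definition kernel_coefs (C : fieldType) (w : nat -> nat -> C) (t : C)
    (K : {poly {poly C}}) : Prop :=
  forall m n, K`_m`_n = ((m == 1%N) && (n == 1%N))%:R - t * w m n.

Definition row_zero (C : fieldType) (w : nat -> nat -> C) (m : nat) : Prop :=
  [/\ w m 0%N = 0, w m 1%N = 0 & w m 2%N = 0].

Definition small_support (C : fieldType) (w : nat -> nat -> C) : Prop :=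
  forall m n, (2 < m)%N || (2 < n)%N -> w m n = 0.

Definition transpose (A : Type) (w : nat -> nat -> A) (m n : nat) : A := w n m.

Lemma small_support_transpose (C : fieldType) (w : nat -> nat -> C) :
  small_support w -> small_support (transpose w).
Proof. by move=> sw m n mn; rewrite /transpose sw // orbC. Qed.

Lemma kernel_coefs_swap (C : fieldType) (w : nat -> nat -> C) t K :
  kernel_coefs w t K -> kernel_coefs (transpose w) t (swapXY K).
Proof. by move=> HK m n; rewrite coef_swapXY HK andbC. Qed.

Lemma unit_swapXY (R : idomainType) (f : {poly {poly R}}) :
  (swapXY f \is a GRing.unit) = (f \is a GRing.unit).
Proof.
have unit_swap (h : {poly {poly R}}) :
    h \is a GRing.unit -> swapXY h \is a GRing.unit.
  case/unitrP=> k [kh hk]; apply/unitrP; exists (swapXY k).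
  by rewrite -!(rmorphM (@swapXY R)) kh hk rmorph1.
by apply/idP/idP => [/unit_swap|/unit_swap //]; rewrite swapXYK.
Qed.

Lemma reducible_swapXY (R : idomainType) (K : {poly {poly R}}) :
  reducible (swapXY K) -> reducible K.
Proof.
case=> f [g [fg nf ng]]; exists (swapXY f), (swapXY g).
by rewrite !unit_swapXY; split=> //; rewrite -(rmorphM (@swapXY R)) -fg /= swapXYK.
Qed.

Lemma size_kernel_coefs (C : fieldType) (w : nat -> nat -> C) t
    (K : {poly {poly C}}) :
  small_support w -> kernel_coefs w t K -> (size K <= 3)%N.
Proof.
move=> sw HK; apply/leq_sizeP => m lem; apply/polyP => n.
by rewrite coef0 (HK m n) sw ?lem // mulr0 subr0; case: m lem => [|[|m]].
Qed.

Lemma size_coef_kernel_coefs (C : fieldType) (w : nat -> nat -> C) t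
    (K : {poly {poly C}}) m :
  small_support w -> kernel_coefs w t K -> (size (K`_m)%R <= 3)%N.
Proof.
move=> sw HK; apply/leq_sizeP => n len; rewrite HK sw ?len ?orbT // mulr0 subr0.
by case: n len => [|[|n]] //; rewrite andbF.
Qed.

Lemma size_kernel_row (C : fieldType) (w : nat -> nat -> C) (t : C) K :
    t != 0 -> small_support w -> kernel_coefs w t K ->
  ((size K).-1 <= 1)%N <-> row_zero w 2%N.
Proof.
move=> t0 sw HK; split=> [sK | [w0 w1 w2]].
  have K2 : K`_2 = 0 by apply: nth_default; case: (size K) sK => [|[|[|k]]].
  by split; apply: (mulfI t0); apply: oppr_inj; rewrite mulr0 oppr0 -[LHS]add0r
    -(HK 2%N) K2 coef0.
suff : (size K <= 2)%N by case: (size K) => [|[|[|k]]].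
apply/leq_sizeP => -[|[|m]] // _; apply/polyP => n; rewrite coef0 HK sub0r.
suff -> : w m.+2 n = 0 by rewrite mulr0 oppr0.
by case: m => [|m]; [case: n => [|[|[|n]]] // | ]; rewrite sw ?orbT.
Qed.

(** The five numbers are the coefficients of the product of the polynomials
    whose coefficients are the rows 0 and 2 of [w]. *)
Lemma row_product_neq0 (C : fieldType) (w : nat -> nat -> C) :
    ~ row_zero w 0%N -> ~ row_zero w 2%N ->
  ~ [/\ w 0%N 0%N * w 2%N 0%N = 0,
        w 0%N 0%N * w 2%N 1%N + w 0%N 1%N * w 2%N 0%N = 0,
        w 0%N 0%N * w 2%N 2%N + w 0%N 1%N * w 2%N 1%N +
          w 0%N 2%N * w 2%N 0%N = 0,
        w 0%N 1%N * w 2%N 2%N + w 0%N 2%N * w 2%N 1%N = 0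
      & w 0%N 2%N * w 2%N 2%N = 0].
Proof.
pose D m := Poly [:: w m 0%N; w m 1%N; w m 2%N].
have D_neq0 m : ~ row_zero w m -> D m != 0.
  move=> nz; apply/eqP => D0; apply: nz.
  have wE k : [:: w m 0; w m 1; w m 2]%N`_k = 0.
    by rewrite -coef_Poly -/(D m) D0 coef0.
  by split; [exact: (wE 0%N) | exact: (wE 1%N) | exact: (wE 2%N)].
move=> /D_neq0 D0 /D_neq0 D2 [M0 M1 M2 M3 M4].
have /eqP[] : D 0%N * D 2%N != 0 by rewrite mulf_neq0.
apply/polyP => k; rewrite coefM coef0.
case: k => [|[|[|[|[|k]]]]]; last first.
  apply: big1 => i _; rewrite !coef_Poly.
  have [i2|i2] := leqP i 2; last by rewrite [X in X * _]nth_default ?mul0r.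
  rewrite [X in _ * X]nth_default ?mulr0 //= ltn_subRL.
  by rewrite (leq_ltn_trans (leq_add i2 (leqnn 2))).
all: by rewrite !big_ord_recr big_ord0 /= !coef_Poly /= !(mulr0, mul0r, addr0, add0r).
Qed.

(** If [w 0 0] is nonzero, the products force row 2 and then row 0 onto the main
    diagonal; otherwise column 0 can only be supported at [w 2 0], and the same
    argument gives the antidiagonal. *)
Lemma support_dichotomy (C : fieldType) (w : nat -> nat -> C) :
    small_support w ->
    ~ row_zero w 0%N -> ~ row_zero w 2%N -> ~ row_zero (transpose w) 0%N ->
    w 1%N 0%N = 0 -> w 1%N 2%N = 0 ->
    w 0%N 0%N * w 2%N 0%N = 0 ->
    w 0%N 0%N * w 2%N 1%N + w 0%N 1%N * w 2%N 0%N = 0 ->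
    w 0%N 1%N * w 2%N 2%N + w 0%N 2%N * w 2%N 1%N = 0 ->
    w 0%N 2%N * w 2%N 2%N = 0 ->
  (forall m n, (m, n) \notin [:: (2, 2); (1, 1); (0, 0)]%N -> w m n = 0) \/
  (forall m n, (m, n) \notin [:: (0, 2); (1, 1); (2, 0)]%N -> w m n = 0).
Proof.
move=> sw row0 row2 col0 w10 w12 M0 M1 M3 M4.
have cancel x y : x != 0 -> x * y = 0 -> y = 0 :> C.
  by move=> x0 xy; apply: (mulfI x0); rewrite xy mulr0.
have [w00|w00] := eqVneq (w 0 0)%N 0.
- have w20 : w 2%N 0%N != 0 by apply/eqP => w20; apply: col0; split.
  rewrite w00 mul0r add0r mulrC in M1.
  have w01 := cancel _ _ w20 M1.
  have w02 : w 0%N 2%N != 0 by apply/eqP => w02; apply: row0; split.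
  rewrite w01 mul0r add0r in M3.
  have w21 := cancel _ _ w02 M3; have w22 := cancel _ _ w02 M4.
  by right=> -[|[|[|m]]] [|[|[|n]]] //= _; apply: sw; rewrite ?orbT.
have w20 := cancel _ _ w00 M0.
rewrite w20 mulr0 addr0 in M1.
have w21 := cancel _ _ w00 M1.
have w22 : w 2%N 2%N != 0 by apply/eqP => w22; apply: row2; split.
rewrite mulrC in M4; have w02 := cancel _ _ w22 M4.
rewrite w02 mul0r addr0 mulrC in M3; have w01 := cancel _ _ w22 M3.
by left=> -[|[|[|m]]] [|[|[|n]]] //= _; apply: sw; rewrite ?orbT.
Qed.

(** * Factors of a kernel at a transcendental parameter *)

Section TranscendentalKernel.

Variables (F : fieldType) (C : closedFieldType) (phi : {rmorphism F -> C}).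
Local Notation alg := (algebraicOver phi).
Variable t : C.
Hypothesis trans_t : ~ alg t.
Let t_neq0 : t != 0 := transcendental_neq0 trans_t.

(** A root [y] of [c] annihilates every row of [K].  Row 0 makes [y] algebraic;
    row 1 expresses [t] as a quotient of [y] by an algebraic number, unless
    [y = 0], which would make column 0 of [w] vanish. *)
Lemma no_univariate_factor (w : nat -> nat -> C) (K g : {poly {poly C}})
    (c : {poly C}) :
    (forall m n, alg (w m n)) -> small_support w ->
    ~ row_zero w 0%N -> ~ row_zero (transpose w) 0%N ->
    kernel_coefs w t K -> K = c%:P * g -> size c = 1%N.
Proof.
move=> aw sw row0 col0 HK Kcg; apply/eqP; apply: contraT => /closed_rootP[y /rootP cy].
have Ky m : \sum_(n < 3) K`_m`_n * y ^+ n = 0.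
  rewrite -(horner_coef_wide _ (size_coef_kernel_coefs _ sw HK)) Kcg coefCM.
  by rewrite hornerM cy mul0r.
have row m : m != 1%N -> w m 0%N + w m 1%N * y + w m 2%N * y ^+ 2 = 0.
  move=> m1; apply: (mulfI t_neq0); rewrite mulr0; apply: oppr_inj; rewrite oppr0.
  rewrite -[RHS](Ky m) !big_ord_recr big_ord0 /= !HK (negPf m1) /=; ring.
have row1 : y = t * (w 1%N 0%N + w 1%N 1%N * y + w 1%N 2%N * y ^+ 2).
  apply/eqP; rewrite -subr_eq0 -(Ky 1%N) !big_ord_recr big_ord0 /= !HK /=.
  by apply/eqP; ring.
have ay : alg y by apply: algebraic_root_quadratic row0 (row _ _).
set W := (X in t * X) in row1.
have aW : alg W.
  rewrite /W expr2.
  by do ?[apply: algebraic_add => // | apply: algebraic_mul => //].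
have y0 : y = 0.
  apply/eqP; apply: contraT => y0; case: trans_t.
  apply: (algebraic_divr (x := W) _ aW ay); first by rewrite mulrC -row1.
  by apply: contra_neq y0 => W0; rewrite row1 W0 mulr0.
case: col0; split; rewrite /transpose.
- by have := row 0%N isT; rewrite y0 !expr2 !mulr0 !addr0.
- apply: (mulfI t_neq0); rewrite mulr0 -y0 [RHS]row1 /W y0; ring.
- by have := row 2%N isT; rewrite y0 !expr2 !mulr0 !addr0.
Qed.

Lemma size_nonunit (K g f : {poly {poly C}}) (w : nat -> nat -> C) :
    (forall m n, alg (w m n)) -> small_support w ->
    ~ row_zero w 0%N -> ~ row_zero (transpose w) 0%N ->
    kernel_coefs w t K -> K = f * g -> f \isn't a GRing.unit -> size f != 1%N.
Proof.
move=> aw sw row0 col0 HK Kfg nf; apply/negP => /eqP f1.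
have fc : f = (f`_0)%:P by apply: size1_polyC; rewrite f1.
rewrite fc in Kfg.
have c1 := no_univariate_factor aw sw row0 col0 HK Kfg.
case/negP: nf; rewrite poly_unitE f1 eqxx poly_unitE c1 eqxx /= unitfE.
have -> : f`_0`_0 = lead_coef f`_0 by rewrite lead_coefE c1.
by rewrite lead_coef_eq0 -size_poly_eq0 c1.
Qed.

(** A factor of size 1 would be univariate, so both sizes are at least 2; their
    sum is at most 4 because [K] has degree at most 2. *)
Lemma factor_sizes (K f g : {poly {poly C}}) (w : nat -> nat -> C) :
    (forall m n, alg (w m n)) -> small_support w ->
    ~ row_zero w 0%N -> ~ row_zero (transpose w) 0%N -> ~ row_zero w 2%N ->
    kernel_coefs w t K -> K = f * g ->
    f \isn't a GRing.unit -> g \isn't a GRing.unit ->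
  (size f <= 2)%N /\ (size g <= 2)%N.
Proof.
move=> aw sw row0 col0 row2 HK Kfg nf ng.
have f1 := size_nonunit aw sw row0 col0 HK Kfg nf.
have g1 := size_nonunit aw sw row0 col0 HK (etrans Kfg (mulrC f g)) ng.
have K0 : K != 0.
  apply/eqP => K0; apply: row2.
  by split; apply: (mulfI t_neq0); apply: oppr_inj;
     rewrite mulr0 oppr0 -[LHS]add0r -(HK 2%N) K0 !coef0.
have := size_kernel_coefs sw HK.
rewrite Kfg mulf_eq0 negb_or in K0; case/andP: K0 => f0 g0.
rewrite Kfg size_mul //; move: f0 g0 f1 g1; rewrite -!size_poly_eq0.
by case: (size f) => [|[|[|a]]] //; case: (size g) => [|[|[|b]]] // _ _ _ _;
   rewrite ?addnS.
Qed.

(** By [factor_sizes] for [K] and for [K] with the variables exchanged, both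
    factors have bidegree at most (1, 1), and [end_coefs_eq0] applies with
    [s = 1 / t]. *)
Lemma reducible_support (K : {poly {poly C}}) (w : nat -> nat -> C) :
    (forall m n, alg (w m n)) -> small_support w ->
    ~ row_zero w 0%N -> ~ row_zero (transpose w) 0%N ->
    ~ row_zero w 2%N -> ~ row_zero (transpose w) 2%N ->
    kernel_coefs w t K -> reducible K ->
  (forall m n, (m, n) \notin [:: (2, 2); (1, 1); (0, 0)]%N -> w m n = 0) \/
  (forall m n, (m, n) \notin [:: (0, 2); (1, 1); (2, 0)]%N -> w m n = 0).
Proof.
move=> aw sw row0 col0 row2 col2 HK [f [g [Kfg nf ng]]].
have [f2 g2] := factor_sizes aw sw row0 col0 row2 HK Kfg nf ng.
have [f2' g2'] : (size (swapXY f) <= 2)%N /\ (size (swapXY g) <= 2)%N.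
  apply: (@factor_sizes (swapXY K) _ _ (transpose w)); rewrite ?unit_swapXY //.
  - by move=> m n; rewrite /transpose.
  - by move=> m n mn; rewrite /transpose sw // orbC.
  - exact: kernel_coefs_swap.
  - by rewrite Kfg (rmorphM (@swapXY C)).
have fx n : (1 < n)%N -> f`_n = 0 by move=> n1; rewrite nth_default ?(leq_trans f2).
have gx n : (1 < n)%N -> g`_n = 0 by move=> n1; rewrite nth_default ?(leq_trans g2).
have fy m n : (1 < n)%N -> f`_m`_n = 0.
  by move=> n1; rewrite -coef_swapXY (nth_default _ (leq_trans f2' n1)) coef0.
have gy m n : (1 < n)%N -> g`_m`_n = 0.
  by move=> n1; rewrite -coef_swapXY (nth_default _ (leq_trans g2' n1)) coef0.
have wE m n : w m n = ((m == 1%N) && (n == 1%N))%:R / t - (f * g)`_m`_n / t.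
  by rewrite -Kfg HK; field; apply: t_neq0.
have w0 n : w 0%N n = - (f`_0 * g`_0)`_n / t.
  by rewrite wE coefM !big_ord_recr big_ord0 /= mul0r !add0r mulNr.
have w1 n : w 1%N n = (n == 1%N)%:R / t - (f`_0 * g`_1 + f`_1 * g`_0)`_n / t.
  by rewrite wE coefM !big_ord_recr big_ord0 /= add0r.
have w2 n : w 2%N n = - (f`_1 * g`_1)`_n / t.
  rewrite wE coefM !big_ord_recr big_ord0 /= (fx 2%N isT) (gx 2%N isT) mulr0 mul0r.
  by rewrite mul0r !add0r addr0 mulNr.
have cM (p q : {poly C}) :
    (forall n, (1 < n)%N -> p`_n = 0) -> (forall n, (1 < n)%N -> q`_n = 0) ->
  [/\ (p * q)`_0 = p`_0 * q`_0, (p * q)`_1 = p`_0 * q`_1 + p`_1 * q`_0 &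
      (p * q)`_2 = p`_1 * q`_1].
  move=> px qx; rewrite !coefM !big_ord_recr !big_ord0 /= (px 2%N isT) (qx 2%N isT).
  by rewrite !(mul0r, mulr0, add0r, addr0).
have [A0 A1 A2] := cM _ _ (fy 0%N) (gy 0%N).
have [B0 B1 B2] := cM _ _ (fy 0%N) (gy 1%N).
have [B0' B1' B2'] := cM _ _ (fy 1%N) (gy 0%N).
have [D0 D1 D2] := cM _ _ (fy 1%N) (gy 1%N).
have aM m n m' n' : alg (w m n * w m' n') by apply: algebraic_mul.
have trans_s : ~ alg t^-1 by move/algebraic_inv; rewrite invrK.
(* The factors [P = f0 g1 / t] and [Q = f1 g0 / t] of [W0 W2]. *)
have [||||||||[b0 b2] [M0 M1 M3 M4]] := @end_coefs_eq0 _ _ phi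
  (w 1 0)%N (w 1 1)%N (w 1 2)%N _ _ _ _ _ t^-1
  (aw _ _) (aw _ _) (aw _ _)
  (aM _ _ _ _) (algebraic_add (aM _ _ _ _) (aM _ _ _ _))
  (algebraic_add (algebraic_add (aM _ _ _ _) (aM _ _ _ _)) (aM _ _ _ _))
  (algebraic_add (aM _ _ _ _) (aM _ _ _ _)) (aM _ _ _ _) trans_s
  (row_product_neq0 row0 row2)
  ((f`_0 * g`_1)`_0 / t) ((f`_0 * g`_1)`_1 / t) ((f`_0 * g`_1)`_2 / t)
  ((f`_1 * g`_0)`_0 / t) ((f`_1 * g`_0)`_1 / t) ((f`_1 * g`_0)`_2 / t);
  last exact: support_dichotomy.
all: rewrite ?w0 ?w1 ?w2 ?coefD ?A0 ?A1 ?A2 ?B0 ?B1 ?B2 ?B0' ?B1' ?B2'.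
all: rewrite ?D0 ?D1 ?D2 /=.
all: by field; apply: t_neq0.
Qed.

End TranscendentalKernel.

(** * Reducible kernels *)

Lemma coef1_nonunit (A : idomainType) (p : {poly A}) :
  p`_1 != 0 -> p \isn't a GRing.unit.
Proof.
move=> p1; rewrite poly_unitE; apply/nandP; left; apply: contra p1 => /eqP sp.
by rewrite nth_default // sp.
Qed.

(** The cofactor of ['X] is not a unit, because a unit is a constant and would
    give [K] no monomial [xy]. *)
Lemma reducible_coef0 (C : idomainType) (K : {poly {poly C}}) :
  K`_0 = 0 -> K`_1`_1 != 0 -> reducible K.
Proof.
move=> K0 K11.
have /factor_theorem[g Kg] : root K 0.
  by rewrite rootE horner_coef0 K0.
rewrite subr0 in Kg.
exists g, 'X; split=> //; last by apply: coef1_nonunit; rewrite coefX oner_eq0.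
apply/negP; rewrite poly_unitE => /andP[_]; rewrite poly_unitE => /andP[/eqP sg _].
by case/eqP: K11; rewrite Kg coefMX /= nth_default // sg.
Qed.

Lemma split_quadratic (C : closedFieldType) (c0 c1 c2 : C) :
  c2 != 0 -> exists a b, c1 = - (c2 * (a + b)) /\ c0 = c2 * a * b.
Proof.
move=> c2_neq0; pose p := Poly [:: c0; c1; c2].
have p_neq1 : size p != 1%N.
  apply/eqP => sp; case/eqP: c2_neq0.
  by have := coef_Poly [:: c0; c1; c2] 2; rewrite -/p nth_default ?sp.
have /closed_rootP[a /rootP pa] := p_neq1.
exists a, (- (c1 / c2) - a); split; first by field.
have : c0 + c1 * a + c2 * a ^+ 2 = 0.
  by rewrite -[RHS]pa horner_Poly /=; ring.
by move/eqP; rewrite -addrA addr_eq0 => /eqP->; field.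
Qed.

(** Used with [(u, v) = (xy, 1)] for the diagonal and [(u, v) = (x, y)] for the
    antidiagonal. *)
Lemma reducible_binary_quadratic (C : closedFieldType) (u v : {poly {poly C}})
    (c0 c1 c2 : C) :
    c2 != 0 -> (forall a : C, (u - a%:P%:P * v)`_1 != 0) ->
  reducible (c2%:P%:P * u ^+ 2 + c1%:P%:P * (u * v) + c0%:P%:P * v ^+ 2).
Proof.
move=> c2_neq0 uv1; have [a [b [-> ->]]] := split_quadratic c0 c1 c2_neq0.
exists (c2%:P%:P * (u - a%:P%:P * v)), (u - b%:P%:P * v); split.
- by rewrite !(polyCN, polyCM, polyCD); ring.
- by apply: coef1_nonunit; rewrite coefCM mulf_neq0 // polyC_eq0.
- exact: coef1_nonunit.
Qed.

Lemma coef_monomialXY (R : comNzRingType) (c : R) (a b m n : nat) :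
  (c%:P%:P * ('X^a * 'Y ^+ b) : {poly {poly R}})`_m`_n
    = c * ((m == a) && (n == b))%:R.
Proof.
rewrite 2!coefCM -(rmorphXn (@polyC {poly R})) coefMC coefXn.
by case: (m == a); rewrite ?mul1r ?mul0r ?coefXn ?coef0.
Qed.

Lemma reducible_row0 (C : fieldType) (w : nat -> nat -> C) (t : C) K :
    small_support w -> kernel_coefs w t K -> 1 - t * w 1%N 1%N != 0 ->
  row_zero w 0%N -> reducible K.
Proof.
move=> sw HK w11 [w0 w1 w2]; apply: reducible_coef0; last by rewrite HK.
apply/polyP => n; rewrite coef0 HK sub0r.
suff -> : w 0%N n = 0 by rewrite mulr0 oppr0.
by case: n => [|[|[|n]]] //; apply: sw.
Qed.

Lemma reducible_diagonal (C : closedFieldType) (w : nat -> nat -> C) (t : C) K :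
    kernel_coefs w t K -> t * w 2%N 2%N != 0 ->
    (forall m n, (m, n) \notin [:: (2, 2); (1, 1); (0, 0)]%N -> w m n = 0) ->
  reducible K.
Proof.
move=> HK w22 diag.
have -> : K = (- (t * w 2%N 2%N))%:P%:P * ('X * 'Y) ^+ 2 +
    (1 - t * w 1%N 1%N)%:P%:P * ('X * 'Y * 1) + (- (t * w 0%N 0%N))%:P%:P * 1 ^+ 2.
  have -> : 'X * 'Y * 1 = 'X^1 * 'Y ^+ 1 :> {poly {poly C}} by rewrite mulr1.
  have -> : 1 ^+ 2 = 'X^0 * 'Y ^+ 0 :> {poly {poly C}} by rewrite expr1n mulr1.
  rewrite exprMn; apply/polyP => m; apply/polyP => n.
  rewrite HK !coefD !coef_monomialXY.
  by case: m => [|[|[|m]]]; case: n => [|[|[|n]]];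
     first [by rewrite diag //=; ring | by rewrite /=; ring].
apply: reducible_binary_quadratic; rewrite ?oppr_eq0 //.
move=> a; rewrite mulr1 coefB coefMC coefX mul1r coefC subr0.
by rewrite polyX_eq0.
Qed.

Lemma reducible_antidiagonal (C : closedFieldType) (w : nat -> nat -> C) (t : C) K :
    kernel_coefs w t K -> t * w 2%N 0%N != 0 ->
    (forall m n, (m, n) \notin [:: (0, 2); (1, 1); (2, 0)]%N -> w m n = 0) ->
  reducible K.
Proof.
move=> HK w20 anti.
have -> : K = (- (t * w 2%N 0%N))%:P%:P * 'X ^+ 2 +
    (1 - t * w 1%N 1%N)%:P%:P * ('X * 'Y) + (- (t * w 0%N 2%N))%:P%:P * 'Y ^+ 2.
  have -> : 'X * 'Y = 'X^1 * 'Y ^+ 1 :> {poly {poly C}} by [].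
  have -> : 'X ^+ 2 = 'X^2 * 'Y ^+ 0 :> {poly {poly C}} by rewrite mulr1.
  have -> : 'Y ^+ 2 = 'X^0 * 'Y ^+ 2 :> {poly {poly C}} by rewrite mul1r.
  apply/polyP => m; apply/polyP => n; rewrite HK !coefD !coef_monomialXY.
  by case: m => [|[|[|m]]]; case: n => [|[|[|n]]];
     first [by rewrite anti //=; ring | by rewrite /=; ring].
apply: reducible_binary_quadratic; rewrite ?oppr_eq0 //.
by move=> a; rewrite coefB coefX coefCM coefC /= mulr0 subr0 oner_eq0.
Qed.

(** * The field generated by the weights *)

Section WeightField.

Variables (R : realType) (d : int -> int -> R).

Definition weight_field_pred : {pred R} := [pred z | `[< in_weight_field d z >]].

Lemma weight_field_divring : divring_closed weight_field_pred.
Proof.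
split; first by apply/asboolP => S [].
- move=> x y /asboolP Fx /asboolP Fy; apply/asboolP => S cS dS.
  by have [_ subS _] := cS; apply: subS; [apply: Fx | apply: Fy].
- move=> x y /asboolP Fx /asboolP Fy; apply/asboolP => S cS dS.
  by have [_ _ divS] := cS; apply: divS; [apply: Fx | apply: Fy].
Qed.

HB.instance Definition _ :=
  GRing.isDivringClosed.Build R weight_field_pred weight_field_divring.

(** The membership predicate of the weight field is turned into a field type so
    that algebraicity over it makes sense. *)
Record weight_field := WeightField {
  weight_field_val :> R;
  _ : weight_field_val \in weight_field_pred }.

HB.instance Definition _ := [isSub for weight_field_val].
HB.instance Definition _ := [Choice of weight_field by <:].
HB.instance Definition _ := [SubChoice_isSubIntegralDomain of weight_field by <:].
HB.instance Definition _ := [SubIntegralDomain_isSubField of weight_field by <:].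

Definition weight_field_complex : {rmorphism weight_field -> R[i]} :=
  (real_complex R \o (val : weight_field -> R)).

End WeightField.

(** * The kernel of a walk *)

Local Open Scope complex_scope.

Section KernelOfWalk.

Variables (R : realType) (d : int -> int -> R) (t : R).

(** [steps] lists the step coordinates in increasing order, so its [m]-th entry is
    [m - 1]; the weight is cut to 0 outside the 3 by 3 array. *)
Definition walk_weight (m n : nat) : R[i] :=
  (d (nth 0 steps m) (nth 0 steps n))%:C *+ ((m < 3)%N && (n < 3)%N).

Lemma walk_weight_small : small_support walk_weight.
Proof.
move=> m n mn; rewrite /walk_weight.
suff -> : (m < 3)%N && (n < 3)%N = false by rewrite mulr0n.
by rewrite !ltnS; case: leqP mn => //= _; case: leqP.
Qed.

Lemma kernel_coefsP : kernel_coefs walk_weight t%:C (kernel d t).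
Proof.
move=> m n; rewrite /kernel /steps !big_cons !big_nil !addr0 !coefB.
congr (_ - _).
  by have := coef_monomialXY (1 : R[i]) 1 1 m n; rewrite !mul1r.
rewrite !coefD !coef_monomialXY /walk_weight.
by case: m => [|[|[|m]]]; case: n => [|[|[|n]]];
   rewrite /= ?mulr1n ?rmorphM /=; ring.
Qed.

Lemma walk_weight_eq0 m n : (m < 3)%N -> (n < 3)%N ->
  walk_weight m n = 0 <-> d (nth 0 steps m) (nth 0 steps n) = 0.
Proof.
move=> m3 n3; rewrite /walk_weight m3 n3 mulr1n.
by split=> [/complexI | ->].
Qed.

Lemma walk_row_zero m : (m < 3)%N -> row_zero walk_weight m <->
  [/\ d (nth 0 steps m) (-1) = 0, d (nth 0 steps m) 0 = 0
    & d (nth 0 steps m) 1 = 0].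
Proof.
move=> m3; have w_eq0 n := @walk_weight_eq0 m n m3.
by split=> -[/(w_eq0 0%N isT) ? /(w_eq0 1%N isT) ? /(w_eq0 2%N isT) ?];
   split; do ?[exact/(w_eq0 _ isT)].
Qed.

Lemma walk_col_zero n : (n < 3)%N -> row_zero (transpose walk_weight) n <->
  [/\ d (-1) (nth 0 steps n) = 0, d 0 (nth 0 steps n) = 0
    & d 1 (nth 0 steps n) = 0].
Proof.
move=> n3; have w_eq0 m (m3 : (m < 3)%N) := @walk_weight_eq0 m n m3 n3.
by split=> -[/(w_eq0 0%N isT) ? /(w_eq0 1%N isT) ? /(w_eq0 2%N isT) ?];
   split; do ?[exact/(w_eq0 _ isT)].
Qed.

Lemma alg_walk_weight m n :
  algebraicOver (weight_field_complex d) (walk_weight m n).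
Proof.
rewrite /walk_weight; case: andP => [[m3 n3]|_]; last first.
  by rewrite mulr0n; apply: algebraic0.
rewrite mulr1n.
have Fd : d (nth 0 steps m) (nth 0 steps n) \in weight_field_pred d.
  by apply/asboolP => S _; apply; apply: mem_nth.
exact: (algebraic_id (weight_field_complex d) (WeightField Fd)).
Qed.

Lemma trans_complex : transcendental_over (in_weight_field d) t ->
  ~ algebraicOver (weight_field_complex d) t%:C.
Proof.
move=> trans_t [p p_neq0]; rewrite map_poly_comp => pt.
case/eqP: p_neq0; apply: (map_poly_inj (val : {rmorphism weight_field d -> R})).
rewrite rmorph0; apply: trans_t.
  by move=> k; rewrite coef_map; apply/asboolP; apply: (valP p`_k).
by move: pt; rewrite fmorph_root.
Qed.

End KernelOfWalk.

Theorem proposition1p2 (R : realType) (d : int -> int -> R) (t : R)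
    (d_itv : {in steps &, forall i j : int, 0 <= d i j <= 1})
    (d_sum : \sum_(i <- steps) \sum_(j <- steps) d i j = 1)
    (t_itv : 0 < t < 1)
    (t_trans : transcendental_over (in_weight_field d) t) :
  degenerate d t <->
  [\/ exists2 i : int, i \in [:: -1; 1] &
        [/\ d i (-1) = 0, d i 0 = 0 & d i 1 = 0],
      exists2 j : int, j \in [:: -1; 1] &
        [/\ d (-1) j = 0, d 0 j = 0 & d 1 j = 0]
    | {in steps &, forall i j : int,
         (i, j) \notin [:: (1, 1); (0, 0); (-1, -1)] -> d i j = 0} \/
      {in steps &, forall i j : int,
         (i, j) \notin [:: (-1, 1); (0, 0); (1, -1)] -> d i j = 0}].
Proof.
case/andP: t_itv => t0 t1.
pose w := walk_weight d; pose K := kernel d t.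
have HK : kernel_coefs w t%:C K by apply: kernel_coefsP.
have HK' := kernel_coefs_swap HK.
have sw : small_support w by apply: walk_weight_small.
have sw' := small_support_transpose sw.
have trans := trans_complex t_trans.
have tC0 := transcendental_neq0 trans.
have w11 : 1 - t%:C * w 1%N 1%N != 0.
  have /andP[_ d00] := d_itv 0 0 isT isT.
  rewrite /w /walk_weight /= mulr1n -rmorphM -(rmorph1 (real_complex R)) -rmorphB.
  rewrite fmorph_eq0 subr_eq0 gt_eqF //.
  by apply: le_lt_trans t1; rewrite ler_piMr // ltW.
have sizeX : ((size K).-1 <= 1)%N <-> row_zero w 2%N := size_kernel_row tC0 sw HK.
have sizeY' : ((sizeY K).-1 <= 1)%N <-> row_zero (transpose w) 2%N.
  by rewrite sizeYE; apply: size_kernel_row tC0 sw' HK'.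
have row0E := walk_row_zero d (isT : (0 < 3)%N).
have row2E := walk_row_zero d (isT : (2 < 3)%N).
have col0E := walk_col_zero d (isT : (0 < 3)%N).
have col2E := walk_col_zero d (isT : (2 < 3)%N).
split.
- move=> deg; rewrite -/K in deg.
  have [/row0E row0|row0] := pselect (row_zero w 0%N).
    by constructor 1; exists (-1).
  have [/row2E row2|row2] := pselect (row_zero w 2%N).
    by constructor 1; exists 1.
  have [/col0E col0|col0] := pselect (row_zero (transpose w) 0%N).
    by constructor 2; exists (-1).
  have [/col2E col2|col2] := pselect (row_zero (transpose w) 2%N).
    by constructor 2; exists 1.
  case: deg => [redK|/sizeX //|/sizeY' //].
  have aw : forall m n, algebraicOver (weight_field_complex d) (w m n).
    by move=> m n; apply: alg_walk_weight.
  constructor 3.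
  have to_steps s s' : (forall m n, (m < 3)%N -> (n < 3)%N ->
      (nth 0 steps m, nth 0 steps n) \notin s' -> (m, n) \notin s) ->
    (forall m n, (m, n) \notin s -> w m n = 0) ->
    {in steps &, forall i j : int, (i, j) \notin s' -> d i j = 0}.
    move=> ss' ws i j /(nthP 0)[m m3 <-] /(nthP 0)[n n3 <-] ij.
    by apply/(walk_weight_eq0 d m3 n3)/ws/ss'.
  have [diag|anti] := reducible_support trans aw sw row0 col0 row2 col2 HK redK;
    [left|right].
    by apply: to_steps diag => -[|[|[|m]]] [|[|[|n]]].
  by apply: to_steps anti => -[|[|[|m]]] [|[|[|n]]].
have of_steps s s' : (forall m n, (m < 3)%N -> (n < 3)%N -> (m, n) \notin s ->
      (nth 0 steps m, nth 0 steps n) \notin s') ->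
    {in steps &, forall i j : int, (i, j) \notin s' -> d i j = 0} ->
    (forall m n, (m, n) \notin s -> w m n = 0).
  move=> ss' ds m n mn; case: (ltnP m 3) => [m3|m3]; last by rewrite sw ?m3.
  case: (ltnP n 3) => [n3|n3]; last by rewrite sw ?n3 ?orbT.
  by apply/(walk_weight_eq0 d m3 n3)/ds; rewrite ?mem_nth //; apply: ss'.
case=> [[i i1 row]|[j j1 col]|[diag|anti]].
- move: i1 row; rewrite !inE => /orP[]/eqP-> row;
    last by constructor 2; apply/sizeX/row2E.
  by constructor 1; apply: reducible_row0 sw HK w11 _; apply/row0E.
- move: j1 col; rewrite !inE => /orP[]/eqP-> col;
    last by constructor 3; apply/sizeY'/col2E.
  constructor 1; apply: reducible_swapXY.
  by apply: reducible_row0 sw' HK' w11 _; apply/col0E.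
- have {}diag : forall m n, (m, n) \notin [:: (2, 2); (1, 1); (0, 0)]%N -> w m n = 0.
    by apply: of_steps diag => -[|[|[|m]]] [|[|[|n]]].
  (* When [w 2 2 = 0] the quadratic in [xy] drops to degree 1 and may be
     irreducible, but then the kernel has [x]-degree at most 1. *)
  have [w22|w22] := eqVneq (w 2 2)%N 0.
    by constructor 2; apply/sizeX; split=> //; apply: diag.
  by constructor 1; apply: reducible_diagonal HK _ diag; rewrite mulf_neq0.
have {}anti : forall m n, (m, n) \notin [:: (0, 2); (1, 1); (2, 0)]%N -> w m n = 0.
  by apply: of_steps anti => -[|[|[|m]]] [|[|[|n]]].
have [w20|w20] := eqVneq (w 2 0)%N 0.
  by constructor 2; apply/sizeX; split=> //; apply: anti.
by constructor 1; apply: reducible_antidiagonal HK _ anti; rewrite mulf_neq0.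
Qed.
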